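(* Let $1\le p<\infty$, let $a<b$ be real numbers, let $f\in C[a,b]$ be real-valued, and let $c_1,c_2\in\mathbb R$ be given constants. Then for every $\epsilon>0$ there exists a $C^1$ function $g:[a,b]\to\mathbb R$ such that $\|g-f\|_{L^p[a,b]}<\epsilon$ and 1. $g(b)=g(a)+c_1$ and $g'(b)=g'(a)+c_2$; 2. $\displaystyle\int_a^b g(x)\,dx=\int_a^b f(x)\,dx$.
   Context: $C^1$ on the closed interval $[a,b]$ means continuously differentiable with one-sided derivatives at the endpoints. *)

(* Defs.v *)
From mathcomp Require Export all_boot all_order all_algebra.
From mathcomp Require Export all_classical all_reals all_analysis.
Export Order.TTheory GRing.Theory Num.Theory numFieldNormedType.Exports.

Set Implicit Arguments.
Unset Strict Implicit.
Unset Printing Implicit Defensive.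

Local Open Scope classical_set_scope.
Local Open Scope ring_scope.

Definition diff_quotient (R : realType) (g : R -> R) (x y : R) : R :=
  (g y - g x) / (y - x).

(* The limit is taken over y in A with y != x; when A is a segment this is the
   two-sided derivative at interior points and the one-sided derivative at the
   endpoints, and the values of g outside A are irrelevant for x in A. *)
Definition derivable_within (R : realType) (A : set R) (g : R -> R) (x : R) :=
  cvg (diff_quotient g x y @[y --> within A x^']).

Definition derive_within (R : realType) (A : set R) (g : R -> R) (x : R) : R :=
  lim (diff_quotient g x y @[y --> within A x^']).

Definition C1_on (R : realType) (A : set R) (g : R -> R) :=
  (forall x, A x -> derivable_within A g x) /\
  {within A, continuous (derive_within A g)}.

(* Main.v *)
Require Import Defs.
From mathcomp Require Import measurable_realfun ring lra zify.

(** The idea: smooth functions are dense in L^p, and the conditions on the ends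
    and on the mean can be met by adding corrections that are small in L^p,
    although they change end values and end slopes by a fixed amount.

    The uniform part: f is extended to the line by a constant on each side of
    [a, b], and P is the average of this extension over [x, x + h].  By the
    fundamental theorem of calculus P is C^1, by the mean value theorem P x is a
    value of the extension within h of x, and so P is uniformly within d of f
    as soon as h is small ([segment_C1_approx]).

    The boundary layer: with t = (x - a) / (b - a) running over [0, 1], a
    combination q of t ^ m and t ^ (2 m) vanishes with its derivative at a,
    and its value and slope at b can be prescribed.  The slopes there are of
    order m, so the two coefficients stay bounded when m grows, and
    |q| <= C t ^ n where C does not depend on n ([boundary_corrector]).
    The integral of t ^ n is (b - a) / (n + 1), and t ^ (n p) <= t ^ n since
    p >= 1; so the layer is negligible both in L^1 and in L^p.

    Finally a constant gam is added to restore the integral of f.  Its size is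
    at most the mean of |P + q - f|, hence at most d + C / (n + 1), and it changes neither
    end difference.  Altogether |g - f| <= 3 d + C t ^ n, and the L^p norm of
    such a function is made small by choosing first d, which determines P and
    hence C, and then n ([Lnorm_boundary_layer],
    [exists_Lnorm_parameter]). *)

Set Implicit Arguments.
Unset Strict Implicit.
Unset Printing Implicit Defensive.

Local Open Scope classical_set_scope.
Local Open Scope ring_scope.

Section C1_density.
Context {R : realType}.
Implicit Types (a b p x : R) (f g dg u : R -> R).
Local Notation mu := (@lebesgue_measure R).

(** * One-sided derivatives on a segment *)

(** Uniqueness of the limit that defines [derive_within] needs each point of a
    nondegenerate segment, endpoints included, to be an accumulation point. *)
Lemma within_segment_dnbhs_proper a b x : a < b -> x \in `[a, b] ->
  ProperFilter (within `[a, b]%classic x^').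
Proof.
move=> ab; rewrite in_itv/= => /andP[ax xb].
apply: Build_ProperFilter_ex => Q [/= r /= r0 hr].
have [xltb|blex] := ltP x b.
  exists (Num.min b (x + r / 2)); apply: hr => /=.
  - rewrite ltr_distlC lt_min gt_min.
    apply/andP; split; [apply/andP; split; lra|apply/orP; right; lra].
  - by rewrite gt_eqF// lt_min xltb/=; lra.
  - rewrite /= in_itv/= ge_min lexx andbT le_min ltW//=; lra.
have xE : x = b by lra.
exists (Num.max a (x - r / 2)); apply: hr => /=.
- rewrite ltr_distlC lt_max gt_max.
  apply/andP; split; [apply/orP; right; lra|apply/andP; split; lra].
- by rewrite lt_eqF// gt_max xE ab/=; lra.
- rewrite /= in_itv/= le_max lexx/= ge_max (ltW ab)/=; lra.
Qed.

Lemma cvg_diff_quotient A g x (d : R) : is_derive x 1 g d ->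
  diff_quotient g x y @[y --> within A x^'] --> d.
Proof.
move=> [gx <-]; have /cvgrPdist_lt gcvg := gx.
apply/cvgrPdist_lt => e e0; have [r /= r0 hr] := gcvg _ e0.
exists r => // y /= xyr yx _.
have := hr (y - x); rewrite /= sub0r normrN distrC subr_eq0 => /(_ xyr yx).
by rewrite /diff_quotient mulrC [_ *: 1]mulr1 subrK.
Qed.

(** Reduces [C1_on] to ordinary derivatives: the approximants built below are
    differentiable in a full neighbourhood of each point of the segment. *)
Lemma C1_on_segment a b g dg : a < b ->
  (forall x, x \in `[a, b] -> is_derive x 1 g (dg x)) ->
  {within `[a, b], continuous dg} ->
  C1_on `[a, b] g /\ {in `[a, b], derive_within `[a, b] g =1 dg}.
Proof.
move=> ab gdg cdg.
have dE : {in `[a, b], derive_within `[a, b] g =1 dg}.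
  move=> x xab; have ? := within_segment_dnbhs_proper ab xab.
  by apply: cvg_lim => //; exact/cvg_diff_quotient/gdg.
split=> //; split.
  by move=> x xab; apply/cvg_ex; exists (dg x); exact/cvg_diff_quotient/gdg.
apply: subspace_eq_continuous cdg => x xab.
by apply/esym/dE; exact: set_mem.
Qed.

(** * Uniform C^1 approximation by averaging *)

Definition clamp a b x := Num.max a (Num.min x b).

Lemma clamp_in a b x : a <= b -> clamp a b x \in `[a, b].
Proof.
by move=> ab; rewrite in_itv/= /clamp le_max lexx/= ge_max ab ge_min lexx orbT.
Qed.

Lemma clamp_id a b : {in `[a, b], clamp a b =1 id}.
Proof.
move=> x; rewrite in_itv/= => /andP[ax xb].
by rewrite /clamp min_l// max_r.
Qed.

Lemma continuous_clamp a b (f : R -> R) : a <= b ->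
  {within `[a, b], continuous f} -> continuous (f \o clamp a b).
Proof.
move=> ab /subspace_continuousP cf x.
have cx : {for x, continuous (cst a \max (id \min cst b) : R -> R^o)}.
  apply: continuous_max; first exact: cvg_cst.
  by apply: continuous_min; [exact: cvg_id|exact: cvg_cst].
have cxab : `[a, b]%classic (clamp a b x) by exact: clamp_in.
apply: (@cvg_comp _ _ _ (clamp a b) f _ (within `[a, b]%classic (nbhs (clamp a b x)))).
  move=> Q /cx Qx; change (nbhs x (clamp a b @^-1` Q)).
  by apply: (@filterS _ (nbhs x) _ _ _ _ Qx) => y; apply; exact: clamp_in.
exact: cf.
Qed.

(** A variant of the Heine theorem in which only one of the two points is
    confined to the segment, as the averaging window overshoots it. *)
Lemma continuous_segment_modulus a b (f : R -> R) (e : R) :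
  continuous f -> 0 < e ->
  exists2 h : R, 0 < h &
    forall x y, x \in `[a, b] -> `|y - x| <= h -> `|f y - f x| <= e.
Proof.
move=> cf e0.
have /compact_near_coveringP cov := @segment_compact R a b.
have := cov R (0^'+) (fun h x => forall y, `|y - x| <= h -> `|f y - f x| <= e) _.
case.
  move=> x _.
  have e20 : 0 < e / 2 by rewrite divr_gt0.
  have /cvgrPdist_lt/(_ _ e20)[r /= r0 hr] := cf x.
  have r20 : 0 < r / 2 by rewrite divr_gt0.
  exists (ball x (r / 2), [set h | h < r / 2]).
    split; first exact: nbhsx_ballx.
    exact: nbhs_right_lt.
  move=> [z h] [/= xz hr2] y yz.
  have fxz := hr z; have fxy := hr y.
  rewrite (le_trans (ler_distD (f x) _ _))//.
  rewrite distrC (splitr e) lerD// ltW//.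
    apply: fxy => /=; rewrite (le_lt_trans (ler_distD z _ _))//.
    rewrite (splitr r) ltrD// distrC; exact: le_lt_trans yz hr2.
  apply: fxz => /=; rewrite (lt_trans xz)//; lra.
move=> r /= r0 hr; exists (r / 2); first by rewrite divr_gt0.
move=> x y xab yx; apply: (hr (r / 2)) => //=; last by rewrite divr_gt0.
by rewrite sub0r normrN gtr0_norm ?divr_gt0//; lra.
Qed.

(** The average over [x, x + h] of a continuous function is C^1 and, by the mean
    value theorem, equal to a value of the function on that window. *)
Lemma segment_C1_approx a b (f : R -> R) (e : R) : a < b ->
  {within `[a, b], continuous f} -> 0 < e ->
  exists P dP : R -> R,
    [/\ forall x, x \in `[a, b] -> is_derive x 1 P (dP x),
        continuous dP
      & forall x, x \in `[a, b] -> `|P x - f x| <= e].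
Proof.
move=> ab cf e0; pose fc := f \o clamp a b.
have cfc : continuous fc by apply: continuous_clamp => //; exact: ltW.
have [h h0 fch] := continuous_segment_modulus a b cfc e0.
(* The primitive starts before a because the fundamental theorem gives its
   derivative only to the right of its origin, and a itself is needed. *)
pose F x := (\int[lebesgue_measure]_(t in `[(a - 1)%R, x]) fc t)%R.
have dF x : a <= x -> is_derive x 1 F (fc x).
  move=> ax; have [||||dFx F'x] := @continuous_FTC1_closed R fc (a - 1) x (x + 1).
  - lra.
  - apply: continuous_compact_integrable; first exact: segment_compact.
    exact: continuous_subspaceT.
  - lra.
  - exact: cfc.
  by rewrite -F'x derive1E; exact: derivableP.
exists (fun x => h^-1 * (F (x + h) - F x)), (fun x => h^-1 * (fc (x + h) - fc x)).
split.
- move=> x; rewrite in_itv/= => /andP[ax xb].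
  have dFh : is_derive x 1 (F \o shift h) (fc (x + h) * 1).
    have axh : a <= x + h by lra.
    exact: (@is_derive1_comp R F (shift h) x _ _ (dF _ axh) (is_derive_shift x 1 h)).
  have dFx := dF _ ax.
  have := is_deriveZ h^-1 (is_deriveB dFh dFx).
  by rewrite mulr1.
- move=> x; apply: cvgM; first exact: cvg_cst.
  apply: cvgB; last exact: cfc.
  apply: (@continuous_comp _ _ _ (shift h) fc); last exact: cfc.
  by apply: cvgD; [exact: cvg_id|exact: cvg_cst].
- move=> x /[dup] xab; rewrite in_itv/= => /andP[ax xb].
  have [|||y yx ->] := @MVT_segment R F fc x (x + h).
  + lra.
  + by move=> y; rewrite in_itv/= => /andP[xy _]; apply: dF; lra.
  + apply: derivable_within_continuous => y; rewrite in_itv/= => /andP[xy _].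
    by have [] := dF y (le_trans ax xy).
  rewrite addrAC subrr add0r mulrC mulfK ?gt_eqF//.
  have -> : f x = fc x by rewrite /fc/= clamp_id.
  apply: fch => //; move: yx; rewrite in_itv/= => /andP[xy yxh].
  by rewrite ger0_norm ?subr_ge0// lerBlDl.
Qed.

(** * Powers of the affine parameter and the boundary layer *)

Lemma integral_deriv_poly a b (q : {poly R}) : a < b ->
  (\int[lebesgue_measure]_(x in `[a, b]) (q^`().[x])%:E = (q.[b] - q.[a])%:E)%E.
Proof.
move=> ab; rewrite (@continuous_FTC2 R _ (horner q)) ?EFinB//.
- apply: continuous_subspaceT; exact: continuous_horner.
- split; first by move=> x _; exact: derivable_horner.
    by apply: cvg_at_right_filter; exact: continuous_horner.
  by apply: cvg_at_left_filter; exact: continuous_horner.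
- by move=> x _; rewrite derive1E derive_val.
Qed.

Definition affine_param a b : {poly R} := (b - a)^-1 *: ('X - a%:P).

Lemma affine_paramE a b x : (affine_param a b).[x] = (x - a) / (b - a).
Proof. by rewrite /affine_param !hornerE mulrC. Qed.

Lemma deriv_affine_param a b : (affine_param a b)^`() = (b - a)^-1%:P.
Proof. by rewrite /affine_param derivZ derivB derivX derivC subr0 alg_polyC. Qed.

Lemma affine_param_itv a b x : a < b -> x \in `[a, b] ->
  0 <= (affine_param a b).[x] <= 1.
Proof.
move=> ab; rewrite in_itv/= affine_paramE => /andP[ax xb].
by rewrite divr_ge0 ?subr_ge0 ?(ltW ab)//= ler_pdivrMr ?subr_gt0// mul1r lerD2r.
Qed.

Lemma integral_boundary_layer a b (K C : R) n : a < b ->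
  (\int[lebesgue_measure]_(x in `[a, b])
     (K + C * (affine_param a b).[x] ^+ n)%:E
   = (K * (b - a) + C * ((b - a) / n.+1%:R))%:E)%E.
Proof.
move=> ab; have ba0 : b - a != 0 by rewrite subr_eq0 gt_eqF.
have n0 : n.+1%:R != 0 :> R by rewrite pnatr_eq0.
set T := affine_param a b.
have Ta : T.[a] = 0 by rewrite affine_paramE subrr mul0r.
have Tb : T.[b] = 1 by rewrite affine_paramE divff.
have dT : T^`() = (b - a)^-1%:P := deriv_affine_param a b.
clearbody T; pose c := C * ((b - a) / n.+1%:R).
pose q := K *: 'X + c *: T ^+ n.+1.
transitivity (\int[lebesgue_measure]_(x in `[a, b]) (q^`().[x])%:E)%E.
  apply: eq_integral => x _; congr EFin.
  rewrite derivD !derivZ derivX deriv_exp dT.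
  rewrite !(hornerD, hornerZ, hornerMn, hornerM, hornerC, horner_exp).
  rewrite -[_ * _ *+ _]mulr_natr mulr1 /c; congr (_ + _).
  by move: n.+1%:R n0 => N N0; field; rewrite ba0 N0.
rewrite integral_deriv_poly// !(hornerD, hornerZ, hornerX, horner_exp) Ta Tb.
by rewrite expr1n expr0n/= /c; congr EFin; ring.
Qed.

(** A power of the parameter has a slope at b proportional to the exponent, so
    the exponents m and 2 m allow for any value and slope at b, with
    coefficients that stay bounded as m grows.  The point is that the factor in
    front of the n-th power does not depend on n. *)
Lemma boundary_corrector a b (d1 d2 : R) n : a < b ->
  exists q : {poly R},
  [/\ q.[b] - q.[a] = d1, q^`().[b] - q^`().[a] = d2 &
      forall x, x \in `[a, b] ->
      `|q.[x]| <= (3 * `|d1| + 2 * (`|d2| * (b - a))) * (affine_param a b).[x] ^+ n].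
Proof.
move=> ab; have ba0 : b - a != 0 by rewrite subr_eq0 gt_eqF.
set T := affine_param a b.
(* An exponent at least 2 makes the slope vanish at a. *)
have [m nm m1] : exists2 m, (n <= m)%N & (1 < m)%N.
  by exists n.+2 => //; rewrite -addn2 leq_addr.
have Xa k : (0 < k)%N -> T.[a] ^+ k = 0.
  by case: k => // k _; rewrite affine_paramE subrr mul0r expr0n.
have Xb k : T.[b] ^+ k = 1 by rewrite affine_paramE divff// expr1n.
have dT : T^`() = (b - a)^-1%:P := deriv_affine_param a b.
have T01 x : x \in `[a, b] -> 0 <= T.[x] <= 1 by exact: affine_param_itv.
clearbody T; have m0 : m%:R != 0 :> R by rewrite pnatr_eq0; lia.
(* The coefficients A, B solve A + B = d1 and m A + 2 m B = d2 (b - a). *)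
pose c := d2 * (b - a) / m%:R.
exists ((2 * d1 - c) *: T ^+ m + (c - d1) *: T ^+ (2 * m)).
split.
- rewrite !(hornerD, hornerZ, horner_exp) !Xb !Xa; [ring|lia..].
- rewrite derivD !derivZ !deriv_exp dT.
  rewrite !(hornerD, hornerZ, hornerMn, hornerM, hornerC, horner_exp).
  rewrite !Xb !Xa; [|lia..].
  rewrite -![(_ * _) *+ _]mulr_natr natrM /c.
  by field; rewrite ba0 m0.
- move=> x xab; have /andP[T0 T1] := T01 _ xab.
  rewrite hornerD !(hornerZ, horner_exp).
  have cle : `|c| <= `|d2| * (b - a).
    rewrite /c !normrM normfV (gtr0_norm (_ : 0 < b - a)) ?subr_gt0//.
    rewrite ler_pdivrMr normr_nat ?ltr0n ?(ltnW m1)// ler_peMr ?ler1n ?(ltnW m1)//.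
    by rewrite mulr_ge0// subr_ge0 ltW.
  have Tm k : (n <= k)%N -> T.[x] ^+ k <= T.[x] ^+ n.
    by move=> nk; exact: ler_wiXn2l.
  have Tk k : 0 <= T.[x] ^+ k by exact: exprn_ge0.
  rewrite (le_trans (ler_normD _ _))// !normrM !normrX (ger0_norm T0).
  apply: (@le_trans _ _ ((`|2 * d1 - c| + `|c - d1|) * T.[x] ^+ n)).
    rewrite [leRHS]mulrDl lerD// ler_wpM2l// Tm//; lia.
  apply: ler_wpM2r => //.
  have := ler_normB (2 * d1) c; have := ler_normB c d1.
  rewrite [`|2 * d1|]normrM normr_nat; lra.
Qed.

(** * Integral and norm of a function dominated by a boundary layer *)

Lemma continuous_segment_integrable a b u : {within `[a, b], continuous u} ->
  mu.-integrable `[a, b] (EFin \o u).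
Proof. by apply: continuous_compact_integrable; exact: segment_compact. Qed.

Lemma within_boundary_layer_continuous a b (K C : R) n :
  {within `[a, b], continuous (fun x => K + C * (affine_param a b).[x] ^+ n)}.
Proof.
rewrite (_ : (fun x => _) = horner (K%:P + C *: affine_param a b ^+ n)).
  by apply: continuous_subspaceT; exact: continuous_horner.
by apply/funext => x; rewrite [RHS]hornerD hornerC [in RHS]hornerZ horner_exp.
Qed.

Lemma norm_Rintegral_boundary_layer a b u (K C : R) n : a < b ->
  {within `[a, b], continuous u} ->
  (forall x, x \in `[a, b] -> `|u x| <= K + C * (affine_param a b).[x] ^+ n) ->
  `|\int[mu]_(x in `[a, b]) u x| <= (b - a) * (K + C / n.+1%:R).
Proof.
move=> ab cu ule.
have iu := continuous_segment_integrable cu.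
have ilayer := continuous_segment_integrable
  (@within_boundary_layer_continuous a b K C n).
apply: (le_trans (le_normr_Rintegral _ iu)) => //.
apply: (@le_trans _ _ (\int[mu]_(x in `[a, b])
    (K + C * (affine_param a b).[x] ^+ n))).
  by apply: le_Rintegral => //; exact: integrable_norm.
rewrite /Rintegral integral_boundary_layer//= le_eqVlt; apply/orP; left.
by apply/eqP; ring.
Qed.

(** The sum is at most twice its larger term. *)
Lemma powRD_le (p x y : R) : 0 <= p -> 0 <= x -> 0 <= y ->
  (x + y) `^ p <= (2 * x) `^ p + (2 * y) `^ p.
Proof.
move=> p0 x0 y0; have [xy|/ltW yx] := leP x y.
  rewrite (@le_trans _ _ ((2 * y) `^ p)) ?lerDr ?powR_ge0//.
  by rewrite ge0_ler_powR// ?nnegrE; lra.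
rewrite (@le_trans _ _ ((2 * x) `^ p)) ?lerDl ?powR_ge0//.
by rewrite ge0_ler_powR// ?nnegrE; lra.
Qed.

(** The p-th power of the n-th power of the parameter is bounded by the n-th
    power itself since p >= 1, so its integral is the explicit one of
    [integral_boundary_layer]; the cruder [powRD_le] replaces the triangle
    inequality of the norm. *)
Lemma Lnorm_boundary_layer p a b u (K C : R) n : 1 <= p -> a < b ->
  0 <= K -> 0 <= C -> {within `[a, b], continuous u} ->
  (forall x, x \in `[a, b] -> `|u x| <= K + C * (affine_param a b).[x] ^+ n) ->
  ('N[mu]_(p%:E)[EFin \o u \_ `[a, b]] <=
   (((2 * K) `^ p * (b - a) + (2 * C) `^ p * ((b - a) / n.+1%:R)) `^ p^-1)%:E)%E.
Proof.
move=> p1 ab K0 C0 cu ule; have p0 : 0 < p by exact: lt_le_trans p1.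
rewrite unlock -poweR_EFin.
apply: gt0_ler_poweR.
- by rewrite invr_ge0 ltW.
- by rewrite in_itv/= leey andbT; apply: integral_ge0 => x _; rewrite lee_fin powR_ge0.
- rewrite in_itv/= leey andbT lee_fin.
  by rewrite addr_ge0// mulr_ge0 ?powR_ge0 ?divr_ge0// subr_ge0 ltW.
rewrite -integral_boundary_layer//.
rewrite [leLHS](_ : _ = \int[mu]_(x in `[a, b]) (`|u x| `^ p)%:E)%E; last first.
  rewrite [RHS]integral_mkcond; apply: eq_integral => x _ /=.
  rewrite !patchE; case: ifPn => //= _.
  have -> : point = 0 :> R by [].
  by rewrite normr0 powR0// gt_eqF.
apply: ge0_le_integral => //.
- apply/measurable_EFinP.
  apply: (@measurableT_comp _ _ _ _ _ _ (@powR R ^~ p)) => //.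
  apply: measurableT_comp => //.
  by apply: subspace_continuous_measurable_fun.
- apply/measurable_EFinP; apply: subspace_continuous_measurable_fun => //.
  exact: within_boundary_layer_continuous.
move=> x xab; have /andP[T0 T1] := affine_param_itv ab xab.
set T := (affine_param a b).[x] in T0 T1 *.
have Tn0 : 0 <= T ^+ n by exact: exprn_ge0.
have Tn1 : T ^+ n <= 1 by exact: exprn_ile1.
have CT0 : 0 <= C * T ^+ n by exact: mulr_ge0.
rewrite lee_fin (@le_trans _ _ ((K + C * T ^+ n) `^ p))//.
  rewrite ge0_ler_powR// ?nnegrE ?(ltW p0)// ?addr_ge0//.
  exact: ule.
apply: (le_trans (powRD_le (ltW p0) K0 CT0)); rewrite lerD2l.
rewrite mulrA powRM// ?mulr_ge0//.
rewrite ler_wpM2l ?powR_ge0//.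
(* [ger_powR] compares powers of a positive base only. *)
move: Tn0 Tn1; rewrite le_eqVlt => /predU1P[<- _|Tn0 Tn1].
  by rewrite powR0// gt_eqF.
by rewrite -[leRHS]powRr1 ?(ltW Tn0)// ger_powR// Tn0.
Qed.

(** The order of the quantifiers matters: d must be chosen before C, since the
    slopes of the uniform approximation, which determine C, depend on d. *)
Lemma exists_Lnorm_parameter p (L eps : R) : 1 <= p -> 0 < L -> 0 < eps ->
  exists2 d : R, 0 < d & forall C, 0 <= C -> exists2 n : nat, C / n.+1%:R <= d &
  ((2 * (3 * d)) `^ p * L + (2 * C) `^ p * (L / n.+1%:R)) `^ p^-1 < eps.
Proof.
move=> p1 L0 eps0; have p0 : 0 < p by exact: lt_le_trans p1.
pose eta := eps `^ p; have eta0 : 0 < eta by exact: powR_gt0.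
(* With 6 d = r the first term is eps ^ p / 4, which leaves room for a second
   term of at most that size once n is large. *)
pose r := (eta / (4 * L)) `^ p^-1.
have r0 : 0 < r by rewrite powR_gt0// divr_gt0// mulr_gt0.
have rp : r `^ p = eta / (4 * L).
  by rewrite /r -powRrM mulVf ?gt_eqF// powRr1// divr_ge0 ?mulr_ge0// ltW.
exists (r / 6); first by rewrite divr_gt0.
move=> C C0; pose M := C / (r / 6) + (2 * C) `^ p * L / (eta / 4).
have A0 : 0 <= C / (r / 6) by rewrite !divr_ge0// ltW.
have B0 : 0 <= (2 * C) `^ p * L / (eta / 4).
  by rewrite !divr_ge0 ?mulr_ge0 ?powR_ge0// ltW.
have [n Mn] : exists n, M <= n.+1%:R.
  exists (Num.bound M); rewrite (le_trans (ltW (archi_boundP _))) ?addr_ge0//.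
  by rewrite ler_nat.
have n0 : 0 < n.+1%:R :> R by rewrite ltr0n.
exists n.
  rewrite ler_pdivrMr// [leRHS]mulrC -ler_pdivrMr ?divr_gt0//.
  by apply: le_trans Mn; rewrite lerDl.
have Bn : (2 * C) `^ p * (L / n.+1%:R) <= eta / 4.
  rewrite mulrA ler_pdivrMr// [leRHS]mulrC -ler_pdivrMr ?divr_gt0//.
  by apply: le_trans Mn; rewrite lerDr.
have -> : 2 * (3 * (r / 6)) = r by field.
rewrite rp.
have -> : eta / (4 * L) * L = eta / 4 by field; rewrite gt_eqF.
have -> : eps = eta `^ p^-1.
  by rewrite /eta -powRrM divff ?gt_eqF// powRr1// ltW.
have : 0 <= (2 * C) `^ p * (L / n.+1%:R) by rewrite mulr_ge0 ?powR_ge0 ?divr_ge0// ltW.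
move: (_ * (L / _)) Bn => B Bn B1.
by rewrite gt0_ltr_powR ?invr_gt0// ?nnegrE; lra.
Qed.

End C1_density.

(** * Density with prescribed end conditions *)

Local Open Scope ereal_scope.

Theorem theorem2 (R : realType) (p a b c1 c2 : R) (f : R -> R)
    (hp : (1 <= p)%R) (hab : (a < b)%R)
    (hf : {within `[a, b], continuous f}) :
  forall eps : R, (0 < eps)%R ->
  exists g : R -> R,
    [/\ C1_on `[a, b] g,
        'N[lebesgue_measure]_(p%:E)[EFin \o ((g \- f)%R \_ `[a, b])] < eps%:E,
        (g b = g a + c1)%R,
        (derive_within `[a, b] g b = derive_within `[a, b] g a + c2)%R
      & \int[lebesgue_measure]_(x in `[a, b]) (g x)%:E =
        \int[lebesgue_measure]_(x in `[a, b]) (f x)%:E].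
Proof.
move=> eps eps0; have L0 : (0 < b - a)%R by rewrite subr_gt0.
have [d d0 dP] := exists_Lnorm_parameter hp L0 eps0.
have [P [P' [PP' cP' Pf]]] := segment_C1_approx hab hf d0.
pose d1 := (c1 - (P b - P a))%R; pose d2 := (c2 - (P' b - P' a))%R.
pose C := (3 * `|d1| + 2 * (`|d2| * (b - a)))%R.
have C0 : (0 <= C)%R by rewrite addr_ge0// !mulr_ge0// ltW.
have [n Cn epsn] := dP C C0.
have [q [qd1 qd2 qC]] := boundary_corrector d1 d2 n hab.
pose u x := (P x + q.[x] - f x)%R.
have cP : {within `[a, b], continuous P}.
  by apply: derivable_within_continuous => x /PP'[].
have cq (s : {poly R}) : {within `[a, b], continuous (horner s)}.
  by apply: continuous_subspaceT; exact: continuous_horner.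
have cu : {within `[a, b], continuous u}.
  move=> x; apply: cvgB; last exact: hf.
  by apply: cvgD; [exact: cP|exact: cq].
have ule x : x \in `[a, b] ->
    (`|u x| <= d + C * (affine_param a b).[x] ^+ n)%R.
  move=> xab; rewrite /u addrAC (le_trans (ler_normD _ _))// lerD ?Pf//.
  exact: qC.
(* The constant that makes the integral of g - f vanish. *)
pose gam := (- (\int[lebesgue_measure]_(x in `[a, b]) u x) / (b - a))%R.
have gamle : (`|gam| <= 2 * d)%R.
  rewrite /gam normrM normrN normfV (gtr0_norm L0) ler_pdivrMr//.
  apply: (le_trans (norm_Rintegral_boundary_layer hab cu ule)).
  by rewrite mulrC ler_pM2r// mulr_natl mulr2n lerD2l.
pose s := (q + gam%:P)%R.
have sE x : s.[x] = (q.[x] + gam)%R by rewrite hornerD hornerC.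
have s'E x : s^`().[x] = (q^`()).[x] by rewrite derivD derivC addr0.
pose g x := (P x + s.[x])%R.
have gfE x : (g x - f x = u x + gam)%R by rewrite /g sE /u; ring.
have gg' x : x \in `[a, b] -> is_derive x 1%R g (P' x + s^`().[x])%R.
  by move=> /PP' ?; apply: is_deriveD.
have [|C1g g'E] := C1_on_segment hab gg'.
  move=> x; apply: cvgD; last exact: cq.
  exact: (continuous_subspaceT cP').
have aab : a \in `[a, b] by rewrite in_itv/= lexx ltW.
have bab : b \in `[a, b] by rewrite in_itv/= lexx ltW.
exists g; split => //.
- have cgf : {within `[a, b], continuous (g \- f)%R}.
    move=> x; apply: cvgB; last exact: hf.
    by apply: cvgD; [exact: cP|exact: cq].
  have d30 : (0 <= 3 * d)%R by rewrite mulr_ge0// ltW.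
  apply: (le_lt_trans (Lnorm_boundary_layer hp hab d30 C0 cgf (n := n) _)).
    move=> x xab; rewrite /= gfE (le_trans (ler_normD _ _))//.
    have := ule x xab; lra.
  by rewrite lte_fin.
- rewrite /g !sE; move: qd1; rewrite /d1; lra.
- rewrite !g'E// !s'E; move: qd2; rewrite /d2; lra.
have iu := continuous_segment_integrable cu.
have if_ := continuous_segment_integrable hf.
have igam : lebesgue_measure.-integrable `[a, b] (EFin \o cst gam).
  by apply: continuous_segment_integrable => x; exact: cvg_cst.
transitivity (\int[lebesgue_measure]_(x in `[a, b])
    ((f x)%:E + ((u x)%:E + gam%:E))).
  apply: eq_integral => x _; rewrite -!EFinD -gfE; congr EFin; ring.
rewrite integralD//=; last exact: integrableD.
rewrite integralD//= integral_cst//= lebesgue_measure_itv/= lte_fin hab.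
rewrite -EFinD -EFinM -[X in _ + (X + _)]fineK; last exact: integrable_fin_num.
by rewrite -EFinD /gam divfK ?gt_eqF// subrr adde0.
Qed.
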